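(* Let $R$ be an associative ring with identity, $M$ a regular right $R$-module, and $m_1,m_2\in M$. Then $m_1\leq_{J}m_2$ if and only if $m_1\leq^{-}m_2$.
   Context: Rings are associative with identity, and modules are unitary right modules. For a right $R$-module $M$, let $S=\mathrm{End}_R(M)$ and $M^*=\mathrm{Hom}_R(M,R)$. For $m\in M$ and $\varphi\in M^*$, write $\varphi m:=\varphi(m)\in R$, and let $m\varphi\in S$ denote the endomorphism $x\mapsto m\,\varphi(x)$ of $M$. An element $m\in M$ is (Zelmanowitz) regular if $m=m\varphi m$, i.e. $m=m\,\varphi(m)$, for some $\varphi\in M^*$. The module $M$ is regular if every element of $M$ is regular. Minus order: for $m_1,m_2\in M$, $m_1\leq^{-}m_2$ means that there exists $\varphi\in M^*$ such that $m_1=m_1\varphi m_1$, $m_1\varphi=m_2\varphi$ (in $S$), and $\varphi m_1=\varphi m_2$ (in $R$). Relation $\leq_J$: for $m_1,m_2\in M$, $m_1\leq_J m_2$ means that there exist idempotent elements $f\in S$ and $a\in R$ such that $m_1=fm_2=m_2a$. *)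

(* Defs.v *)
From HB Require Import structures.
From mathcomp Require Import all_boot all_algebra.

Set Implicit Arguments.
Unset Strict Implicit.
Unset Printing Implicit Defensive.

Import GRing.Theory.
Local Open Scope ring_scope.

(* MathComp modules are left modules, so a right R-module is a left module    *)
(* over the converse ring R^c. A ring is a pzRingType, so that the zero ring  *)
(* is allowed.                                                                *)
Notation rmodType R := (lmodType R^c).

Section RightModules.

Variables (R : pzRingType) (M : rmodType R).

Definition ract (m : M) (a : R) : M := (a : R^c) *: m.

(* R^c^o is R as a right module over itself: the scalar a sends x to x * a.   *)
Definition rdual := {linear M -> R^c^o}.

Definition rEnd := {linear M -> M}.

Definition rapp (phi : rdual) (m : M) : R := phi m.

Definition rank1_fun (m : M) (phi : rdual) (x : M) : M := ract m (rapp phi x).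

Fact rank1_fun_is_linear m phi : linear (rank1_fun m phi).
Proof.
by move=> a x y; rewrite /rank1_fun /ract /rapp linearP scalerDl scalerA.
Qed.

HB.instance Definition _ m phi :=
  GRing.isLinear.Build R^c M M _ (rank1_fun m phi) (rank1_fun_is_linear m phi).

Definition rank1 (m : M) (phi : rdual) : rEnd := rank1_fun m phi.

Definition zregular (m : M) : Prop :=
  exists phi : rdual, m = ract m (rapp phi m).

(* Equality in End_R(M) is equality of the underlying maps.                   *)
Definition minus_le (m1 m2 : M) : Prop :=
  exists phi : rdual,
    [/\ m1 = ract m1 (rapp phi m1),
        rank1 m1 phi =1 rank1 m2 phi
      & rapp phi m1 = rapp phi m2].

Definition J_le (m1 m2 : M) : Prop :=
  exists (f : rEnd) (a : R),
    [/\ idempotent_fun f, a * a = a, m1 = f m2 & m1 = ract m2 a].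

End RightModules.

Definition zregular_module (R : pzRingType) (M : rmodType R) : Prop :=
  forall m : M, zregular m.

(* Main.v *)
(* For the direct implication, if m1 = f m2 = m2 a and m1 = m1 psi m1, the
   functional a psi f : x |-> a * psi (f x) witnesses m1 <=^- m2.  Conversely,
   if phi witnesses m1 <=^- m2, take f = m1 phi and a = phi m1. *)
From HB Require Import structures.
Require Import Defs.
From mathcomp Require Import all_boot all_algebra.

Set Implicit Arguments.
Unset Strict Implicit.
Unset Printing Implicit Defensive.

Import GRing.Theory.
Local Open Scope ring_scope.

Section RightModuleTheory.

Variables (R : pzRingType) (M : rmodType R).
Implicit Types (m x : M) (a b : R) (phi : rdual M).

Lemma ractA m a b : ract (ract m a) b = ract m (a * b).
Proof. by rewrite /ract scalerA. Qed.

Lemma rapp_ract phi m a : rapp phi (ract m a) = rapp phi m * a.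
Proof. exact: linearZ_LR. Qed.

(** Values are typed in [R^c^o], where scalars act by right multiplication in [R], so left
    multiplication by [a] is linear. *)
Definition lmul_comp_fun a phi (f : rEnd M) x : R^c^o := a * rapp phi (f x).

Fact lmul_comp_fun_is_linear a phi f : linear (lmul_comp_fun a phi f).
Proof.
move=> c x y; rewrite /lmul_comp_fun /rapp !linearP [LHS]mulrDr.
(* Unfolding the converse product leaves [a * (u * c) = (a * u) * c] in [R], with
   [u = phi (f x)]. *)
congr (_ + _); exact: (@mulrA R).
Qed.

HB.instance Definition _ a phi f :=
  GRing.isLinear.Build R^c M R^c^o _ (lmul_comp_fun a phi f)
    (lmul_comp_fun_is_linear a phi f).

Definition lmul_comp a phi f : rdual M := lmul_comp_fun a phi f.

Lemma lmul_compE a phi f x : rapp (lmul_comp a phi f) x = a * rapp phi (f x).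
Proof. by []. Qed.

Lemma rank1E m phi x : rank1 m phi x = ract m (rapp phi x).
Proof. by []. Qed.

Lemma minus_le_J_le m1 m2 : minus_le m1 m2 -> J_le m1 m2.
Proof.
move=> [phi [m1E m12 phi12]]; exists (rank1 m1 phi), (rapp phi m1); split.
(* [m1 phi(m1) phi(x)] collapses to [m1 phi(x)]. *)
- by move=> x; rewrite /= !rank1E rapp_ract -ractA -m1E.
- by rewrite -rapp_ract -m1E.
- by rewrite rank1E -phi12.
(* Evaluate [m1 phi = m2 phi] at [m1]. *)
- by rewrite -rank1E -m12 rank1E.
Qed.

Lemma J_le_minus_le m1 m2 : zregular m1 -> J_le m1 m2 -> minus_le m1 m2.
Proof.
move=> [psi m1E] [f [a [ff aa m1f m1a]]].
(* As an image under the idempotents [f] and [a], [m1] is fixed by both. *)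
have fm1 : f m1 = m1 by rewrite {1}m1f m1f; apply: ff.
have am1 : ract m1 a = m1 by rewrite m1a ractA aa.
exists (lmul_comp a psi f); split.
- by rewrite lmul_compE fm1 -ractA am1.
(* The left factor [a] is absorbed: [m1 a = m1 = m2 a]. *)
- by move=> x; rewrite !rank1E lmul_compE -!ractA am1 -m1a.
- by rewrite !lmul_compE fm1 -m1f.
Qed.

End RightModuleTheory.

Theorem theorem3p6 (R : pzRingType) (M : rmodType R)
  (regM : zregular_module M) (m1 m2 : M) :
  J_le m1 m2 <-> minus_le m1 m2.
Proof.
by split; [apply: J_le_minus_le; apply: regM | apply: minus_le_J_le].
Qed.
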